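(* Let $X$ be a locally compact Hausdorff space. An element $f\in C_0(X)$ is a left-symmetric point of $C_0(X)$ if and only if either $f$ is identically zero, or $M_f$ is a singleton and $f$ vanishes outside $M_f$.
   Context: $\mathbb{K}$ is $\mathbb{R}$ or $\mathbb{C}$. $C_0(X)$ is the space of continuous functions $X\to\mathbb{K}$ vanishing at infinity, with the supremum norm $\|\cdot\|$. For $f\in C_0(X)$, $M_f:=\{x\in X:|f(x)|=\|f\|\}$. In a normed space $\mathbb{X}$ over $\mathbb{K}$, $x\perp_B y$ (Birkhoff-James orthogonality) means $\|x+\lambda y\|\ge\|x\|$ for all $\lambda\in\mathbb{K}$; $x\in\mathbb{X}$ is left-symmetric if $x\perp_B y$ implies $y\perp_B x$ for every $y\in\mathbb{X}$. *)

(* Defs.v *)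
From HB Require Import structures.
From mathcomp Require Import all_boot all_order all_algebra.
From mathcomp Require Import complex.
From mathcomp Require Import all_classical all_reals all_analysis.

Set Implicit Arguments.
Unset Strict Implicit.
Unset Printing Implicit Defensive.

Import Order.TTheory GRing.Theory Num.Theory.
Import numFieldTopology.Exports numFieldNormedType.Exports.
Local Open Scope classical_set_scope.
Local Open Scope ring_scope.
Local Open Scope complex_scope.

Definition bj_orthogonal {K : numFieldType} {V : normedModType K}
    (x y : V) : Prop :=
  forall l : K, `|x + l *: y| >= `|x|.

Definition left_symmetric {K : numFieldType} {V : normedModType K}
    (x : V) : Prop :=
  forall y : V, bj_orthogonal x y -> bj_orthogonal y x.

Variant scalars := real_scalars | complex_scalars.

Definition scalar_field (R : realType) (s : scalars) : numFieldType :=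
  match s with real_scalars => R | complex_scalars => R[i] end.

Definition vanishes_at_infinity {X : topologicalType} {K : numFieldType}
    (f : X -> K) : Prop :=
  forall e : K, 0 < e ->
    exists2 C : set X, compact C & forall x, ~ C x -> `|f x| < e.

Section C0.
Variables (X : topologicalType) (K : numFieldType).

Definition C0_pred : {pred X -> K} :=
  fun f => `[< continuous f /\ vanishes_at_infinity f >].

Record C0 := MkC0 { C0_fun :> X -> K ; _ : C0_fun \in C0_pred }.

HB.instance Definition _ := [isSub for C0_fun].
HB.instance Definition _ := [Choice of C0 by <:].

Lemma C0_predP (f : X -> K) :
  reflect (continuous f /\ vanishes_at_infinity f) (f \in C0_pred).
Proof. exact: asboolP. Qed.

Lemma C0_continuous (f : C0) : continuous f.
Proof. by have /C0_predP[] := valP f. Qed.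

Lemma C0_vanishes (f : C0) : vanishes_at_infinity f.
Proof. by have /C0_predP[] := valP f. Qed.

Lemma C0_submod : submod_closed C0_pred.
Proof.
split=> [|a f g].
  apply/C0_predP; split; first by move=> x; exact: cst_continuous.
  by move=> e e0; exists set0; [exact: compact0 | move=> x _; rewrite normr0].
move=> /C0_predP[cf vf] /C0_predP[cg vg]; apply/C0_predP; split.
  move=> x; apply: (@cvgD K K) (cg x).
  exact: cvgM (@cvg_cst _ _ _ _ _) (cf x).
move=> e e0; have a1 : 0 < `|a| + 1 by rewrite ltr_wpDl.
have e20 : 0 < e / 2 by rewrite divr_gt0.
have [C cC fC] := vf (e / 2 / (`|a| + 1)) (divr_gt0 e20 a1).
have [D cD gD] := vg (e / 2) e20.
exists (C `|` D); first exact: compactU.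
move=> x /not_orP[/fC fx /gD gx].
rewrite (le_lt_trans (ler_normD _ _))// [ltRHS]splitr ler_ltD//.
rewrite normrM; rewrite ltr_pdivlMr// in fx.
apply: le_trans (ltW fx); rewrite mulrC ler_wpM2l//.
by rewrite lerDl.
Qed.

HB.instance Definition _ := GRing.isSubmodClosed.Build K (X -> K) C0_pred
  C0_submod.
HB.instance Definition _ := [SubChoice_isSubLmodule of C0 by <:].

(* Norms of a [normedModType K] take their values in K itself.  For K = R[i]
   the order is the partial order z <= w <-> w - z is a nonnegative real, so
   this least upper bound is the (real) supremum embedded in K.  The default
   value 0 is the norm when X is empty. *)
Definition C0_norm (f : C0) : K := supremum 0 (range (fun x => `|f x|)).

Lemma C0_bounded (f : C0) : exists M : K, forall x, `|f x| <= M.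
Proof.
have [C cC fC] := C0_vanishes f ltr01.
have /compact_near_coveringP/(_ _ +oo (fun M x => `|f x| <= M)) nC := cC.
have : \forall M \near +oo, C `<=` (fun x => `|f x| <= M).
  apply: nC => x Cx; near=> y M => /=.
  have fy : `|f y| <= `|f x| + 1.
    rewrite -lerBlDl (le_trans (lerB_dist _ _))// ltW//.
    near: y; apply: (@cvgr_distC_lt _ _ _ _ _ f (f x)) => //.
    exact: C0_continuous.
  apply: le_trans fy _; near: M; apply: nbhs_pinfty_ge.
  by rewrite ger0_real// addr_ge0.
move=> [M0 [M0real M0C]]; exists (`|M0| + 1) => x.
have [Cx|/fC fx] := pselect (C x).
  apply: (M0C (`|M0| + 1)) => //.
  by rewrite (le_lt_trans (real_ler_norm _))// ltrDl.
by rewrite (le_trans (ltW fx))// lerDr.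
Unshelve. all: by end_near. Qed.

End C0.

Section C0_normed.
Variables (R : realType) (s : scalars) (X : topologicalType).
Local Notation K := (scalar_field R s).
Implicit Types f g : C0 X K.

Lemma scalar_field_has_sup (A : set K) (M : K) : A !=set0 ->
  (forall a, A a -> 0 <= a <= M) -> supremums A !=set0.
Proof.
case: s A M => /= A M A0 AM.
  have hA : has_ubound A by exists M => a /AM /andP[].
  exists (sup A); split; first exact: ub_le_sup.
  by move=> b Ab; exact: ge_sup.
pose B := [set complex.Re z | z in A].
have AB z : A z -> z = (complex.Re z)%:C.
  by case: z => a b /AM /andP[]; rewrite lecE /= => /andP[/eqP ->].
have hB : has_ubound B.
  exists (complex.Re M) => _ [z /AM /andP[_ +] <-].
  by rewrite lecE => /andP[].
exists (sup B)%:C; split.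
  by move=> z Az; rewrite (AB _ Az) lecR ub_le_sup//; exists z.
move=> b Ab; rewrite lecE /=; apply/andP; split.
  by have [z Az] := A0; have := Ab _ Az; rewrite (AB _ Az) lecE => /andP[].
apply: ge_sup; first by have [z Az] := A0; exists (complex.Re z); exists z.
by move=> _ [z /Ab + <-]; rewrite lecE => /andP[].
Qed.

Lemma C0_norm_ge f x : `|f x| <= C0_norm f.
Proof.
rewrite /C0_norm /supremum; case: ifPn => [/eqP A0|_].
  by suff : set0 `|f x| by []; rewrite -A0; exists x.
have [M fM] := C0_bounded f.
have [|_ [y _ <-]|m mP] := @scalar_field_has_sup (range (fun x => `|f x|)) M.
- by exists `|f x|; exists x.
- by rewrite normr_ge0 fM.
by case: xgetP => [z zA [+ _]|/(_ m)//]; apply; exists x.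
Qed.

Lemma C0_norm_le f (M : K) :
  0 <= M -> (forall x, `|f x| <= M) -> C0_norm f <= M.
Proof.
move=> M0 fM; rewrite /C0_norm /supremum; case: ifPn => // _.
by case: xgetP => // z zA [_]; apply => _ [x _ <-].
Qed.

Lemma C0_norm_ge0 f : 0 <= C0_norm f.
Proof.
have [[x _]|X0] := pselect (exists x : X, True).
  exact: le_trans (normr_ge0 _) (C0_norm_ge f x).
suff A0 : range (fun x => `|f x|) = set0 by rewrite /C0_norm A0 supremum0.
by rewrite -subset0 => t [x _ _]; apply: X0; exists x.
Qed.

Lemma C0_norm_le_add f g : C0_norm (f + g) <= C0_norm f + C0_norm g.
Proof.
apply: C0_norm_le => [|x]; first by rewrite addr_ge0 ?C0_norm_ge0.
by rewrite (le_trans (ler_normD _ _))// lerD ?C0_norm_ge.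
Qed.

Lemma C0_normZ (l : K) f : C0_norm (l *: f) = `|l| * C0_norm f.
Proof.
have le_ (a : K) (h : C0 X K) : C0_norm (a *: h) <= `|a| * C0_norm h.
  apply: C0_norm_le => [|x]; first by rewrite mulr_ge0 ?C0_norm_ge0.
  by rewrite normrM ler_wpM2l ?C0_norm_ge.
apply/eqP; rewrite eq_le le_/=.
have [->|l0] := eqVneq l 0; first by rewrite normr0 mul0r C0_norm_ge0.
rewrite -{1}(scalerK l0 f) -ler_pdivlMl ?normr_gt0//.
by rewrite -normfV le_.
Qed.

Lemma C0_norm0_eq0 f : C0_norm f = 0 -> f = 0.
Proof.
move=> f0; apply/val_inj/funext => x; apply/eqP.
by rewrite -normr_le0 -f0 C0_norm_ge.
Qed.

HB.instance Definition _ := Lmodule_isNormed.Build K (C0 X K)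
  C0_norm_le_add C0_normZ C0_norm0_eq0.

End C0_normed.

Definition norm_attaining_set {X : topologicalType} {R : realType}
    {s : scalars} (f : C0 X (scalar_field R s)) : set X :=
  [set x | `|f x| = `|f|].

(* Main.v *)
Require Import Defs.
From mathcomp Require Import all_boot all_order all_algebra complex ring.
From mathcomp Require Import all_classical all_reals all_analysis.

Import Order.TTheory GRing.Theory Num.Theory.
Import numFieldTopology.Exports numFieldNormedType.Exports.
Local Open Scope classical_set_scope.
Local Open Scope ring_scope.

(** Two mechanisms drive the equivalence.

    If f is supported at a single point x0 and f _|_ g, then g x0 = 0:
    otherwise a scalar multiple of g lowers |f x0| a little while staying small
    at every other point, where f is zero ([left_symmetric_peak]).  Once
    g x0 = 0, adding multiples of f to g changes g only at a point where g is
    zero, so the norm cannot drop and g _|_ f.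

    Conversely let f be nonzero and left-symmetric.  Since f vanishes at
    infinity, its norm is attained at some x0 ([C0_norm_attained]).  If f were
    also nonzero at some x <> x0, complete regularity would give a continuous
    p : X -> [0, 1] with p x0 = 0 and p x = 1 ([scalar_urysohn]), and g := f p
    would violate symmetry: g vanishes at x0, where f attains its norm, so
    f _|_ g ([bj_orthogonal_vanishing]); but subtracting a small multiple of f
    from g multiplies f by p - t instead of p, which strictly lowers the norm
    because |g| can only be close to its supremum where |f| is bounded away
    from 0 ([cutoff_not_bj_orthogonal]).  Hence f is zero away from x0.

    Norms take values in the scalar field itself, which is only partially
    ordered when it is R[i], so comparisons between its elements are split
    into cases only when both sides are known to be real. *)

Section C0_facts.
Context {R : realType} {s : scalars} {X : topologicalType}.
Local Notation K := (scalar_field R s).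
Implicit Types f g : C0 X K.

Lemma C0_norm_at_le f x : `|f x| <= `|f|.
Proof. exact: C0_norm_ge. Qed.

Lemma C0_norm_le_bound f (M : K) :
  0 <= M -> (forall x, `|f x| <= M) -> `|f| <= M.
Proof. exact: C0_norm_le. Qed.

(** If |f x| < N := `|f| for every x, take a compact set outside which
    |f x| < N / 2.  On it compactness makes the strict bound uniform,
    |f x| <= N - e with 0 < e <= N / 2, so N - e bounds |f x| on all of X,
    contradicting that N is the supremum.  A uniform gap e makes sense over
    both scalar fields, whereas an extreme value theorem would need |f| to be
    real-valued. *)
Lemma C0_norm_attained f : f != 0 -> exists x, `|f x| = `|f|.
Proof.
rewrite -normr_gt0 => f0; apply: contrapT => nf.
have flt x : `|f x| < `|f|.
  by rewrite lt_neqAle C0_norm_at_le andbT; apply/eqP => fx; apply: nf; exists x.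
have [C cC fC] := C0_vanishes f (divr_gt0 f0 (ltr0Sn _ 1)).
have nC : \forall e \near 0^'+, C `<=` (fun x => `|f x| <= `|f| - e).
  move/compact_near_coveringP : cC.
  move=> /(_ _ 0^'+ (fun e x => `|f x| <= `|f| - e)); apply => x _.
  have d0 : 0 < (`|f| - `|f x|) / 2 by rewrite divr_gt0// subr_gt0.
  near=> y e => /=.
  have fy : `|f y| <= `|f x| + (`|f| - `|f x|) / 2.
    rewrite -lerBlDl (le_trans (lerB_dist _ _))// ltW//.
    near: y; apply: (@cvgr_distC_lt _ _ _ _ _ f (f x)) => //.
    exact: C0_continuous.
  apply: le_trans fy _; rewrite lerBrDl -lerBrDr.
  suff -> : `|f| - (`|f x| + (`|f| - `|f x|) / 2) = (`|f| - `|f x|) / 2.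
    by near: e; exact: nbhs_right_le.
  by field.
have nhalf : \forall e \near (0 : K)^'+, e <= `|f| / 2.
  by apply: nbhs_right_le; rewrite divr_gt0.
have [e [[eC eh] e0]] :=
  filter_ex (filterI (filterI nC nhalf) (nbhs_right_gt (0 : K))).
have : `|f| <= `|f| - e; last first.
  by rewrite lerBrDr gerDl lt_geF.
apply: C0_norm_le_bound => [|x].
- rewrite subr_ge0 (le_trans eh)// ler_pdivrMr// ler_pMr// ler1n//.
- have [/eC//|/fC/ltW/le_trans] := pselect (C x); apply.
  by rewrite lerBrDr -lerBrDl {1}[`|f|]splitr addrK.
Unshelve. all: by end_near. Qed.

Lemma C0_cutoff f (p : X -> K) : continuous p -> (forall x, 0 <= p x <= 1) ->
  exists g, forall x, g x = f x * p x.
Proof.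
move=> cp p01.
have gP : (fun x => f x * p x) \in C0_pred (K := K).
  apply/C0_predP; split=> [x|e e0].
    apply: cvgM; [exact: C0_continuous|exact: cp].
  have [C cC fC] := C0_vanishes f e0; exists C => // x /fC; apply: le_lt_trans.
  by rewrite normrM ler_piMr// ger0_norm; have /andP[] := p01 x.
by exists (MkC0 gP).
Qed.

Lemma bj_orthogonal_vanishing f g x :
  norm_attaining_set f x -> g x = 0 -> bj_orthogonal f g.
Proof.
move=> fx gx l; rewrite -fx; apply: le_trans (C0_norm_at_le _ x).
by rewrite -[(f + l *: g) x]/(f x + l * g x) gx mulr0 addr0.
Qed.

(** Subtracting t f from g = f p with t = `|g| / (2 `|f|) strictly lowers the
    norm.  Where p x < t or |f x| <= `|g| / 2, |f x| |p x - t| is at most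
    `|g| / 2; elsewhere it equals |g x| - t |f x| <= `|g| - t (`|g| / 2). *)
Lemma cutoff_not_bj_orthogonal f g (p : X -> K) :
  (forall x, 0 <= p x <= 1) -> (forall x, g x = f x * p x) ->
  g != 0 -> ~ bj_orthogonal g f.
Proof.
move=> p01 gE; rewrite -normr_gt0 => g0.
have gf : `|g| <= `|f|.
  apply: C0_norm_le_bound => // x; apply: le_trans (C0_norm_at_le f x).
  by rewrite gE normrM ler_piMr// ger0_norm; have /andP[] := p01 x.
have f0 := lt_le_trans g0 gf.
pose t := `|g| / `|f| / 2.
have t0 : 0 < t by rewrite !divr_gt0.
have t1 : t <= 1.
  rewrite /t ler_pdivrMr// mul1r (@le_trans _ _ 1)// ?ler_pdivrMr ?mul1r//.
  by rewrite ler1n.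
have tf : t * `|f| = `|g| / 2 by rewrite /t mulrAC divfK ?gt_eqF.
have half : `|g| / 2 <= `|g| - t * (`|g| / 2).
  rewrite lerBrDr -lerBrDl {2}[`|g|]splitr addrK.
  by rewrite ler_piMl// divr_ge0// ltW.
move=> /(_ (- t)); apply/negP; rewrite -real_ltNge ?ger0_real//.
apply: (@le_lt_trans _ _ (`|g| - t * (`|g| / 2))); last first.
  by rewrite ltrBlDr ltrDl mulr_gt0// divr_gt0.
apply: C0_norm_le_bound => [|x]; first exact: le_trans half; rewrite ?divr_ge0.
have /andP[p0 p1] := p01 x.
have -> : (g + - t *: f) x = f x * (p x - t).
  by rewrite -[LHS]/(g x + - t * f x) gE; ring.
rewrite normrM.
have [tp|pt] := real_leP (ger0_real (ltW t0)) (ger0_real p0); last first.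
  apply: le_trans half; rewrite -tf mulrC ler_pM ?C0_norm_at_le//.
    by rewrite subr_ge0 ltW.
  by rewrite gerDl oppr_le0.
have gh0 : 0 <= `|g| / 2 by rewrite divr_ge0.
have [fg|fg] := real_leP (normr_real (f x)) (ger0_real gh0).
  apply: le_trans half; apply: le_trans fg.
  by rewrite ler_piMr// lerBlDr (le_trans p1)// lerDl ltW.
rewrite mulrBr lerB//.
  by rewrite -{1}(ger0_norm p0) -normrM -gE C0_norm_at_le.
by rewrite [leRHS]mulrC ler_wpM2l// ltW.
Qed.

(** If g x0 <> 0, put a := |g x0| and N := `|g|.  The multiplier m below is
    chosen so that f + m g has modulus `|f| N / (a + N) at x0 and at most that
    elsewhere, where only m g contributes; this is less than `|f|. *)
Lemma left_symmetric_peak f x0 : norm_attaining_set f = [set x0] ->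
  (forall x, ~ norm_attaining_set f x -> f x = 0) -> left_symmetric f.
Proof.
move=> fx0 foff.
have Nf : `|f x0| = `|f| by rewrite -[_ = _]/(norm_attaining_set f x0) fx0.
have f_off x : x <> x0 -> f x = 0 by move=> xx0; apply: foff; rewrite fx0.
move=> g fg l.
have [f0|f0] := eqVneq `|f| 0.
  by move/eqP: f0; rewrite normr_eq0 => /eqP ->; rewrite scaler0 addr0.
have {f0}f0 : 0 < `|f| by rewrite lt_neqAle eq_sym f0 normr_ge0.
have [gx0|gx0] := eqVneq (g x0) 0.
  apply: C0_norm_le_bound => // x.
  have [->|/eqP xx0] := eqVneq x x0; first by rewrite gx0 normr0.
  apply: le_trans (C0_norm_at_le _ x).
  by rewrite -[(g + l *: f) x]/(g x + l * f x) f_off// mulr0 addr0.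
exfalso; pose a := `|g x0|; pose D := a + `|g|.
have a0 : 0 < a by rewrite normr_gt0.
have D0 : 0 < D by rewrite ltr_wpDr.
pose m := - (f x0 / g x0 * (a / D)).
have : `|f + m *: g| <= `|f| * (`|g| / D).
  apply: C0_norm_le_bound => [|x]; first by rewrite mulr_ge0// divr_ge0// ltW.
  rewrite -[(f + m *: g) x]/(f x + m * g x).
  have [->|/eqP xx0] := eqVneq x x0.
    have -> : f x0 + m * g x0 = f x0 * (`|g| / D).
      rewrite /m mulNr mulrAC divfK// -{1}[f x0]mulr1 -mulrBr.
      by congr (_ * _); rewrite -(divff (lt0r_neq0 D0)) -mulrBl /D addrC addKr.
    by rewrite normrM Nf ger0_norm// divr_ge0// ltW.
  rewrite f_off// add0r normrM normrN normrM normf_div Nf -/a.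
  rewrite (ger0_norm (divr_ge0 (ltW a0) (ltW D0))).
  have -> : `|f| / a * (a / D) = `|f| / D by rewrite mulrA divfK ?gt_eqF.
  rewrite mulrAC -mulrA ler_wpM2l//.
  by rewrite ler_wpM2r ?C0_norm_at_le// invr_ge0 ltW.
move=> /(le_trans (fg m)); apply/negP; rewrite -real_ltNge ?ger0_real//.
  by rewrite gtr_pMr// ltr_pdivrMr// mul1r ltrDr.
by rewrite mulr_ge0// divr_ge0// ltW.
Qed.

End C0_facts.

(** Transports real-valued Urysohn functions to either scalar field. *)
Lemma scalar_embedding (R : realType) (s : scalars) :
  exists i : R -> scalar_field R s, [/\ continuous i, i 0 = 0, i 1 = 1 &
    {mono i : x y / x <= y}].
Proof.
case: s => /=; first by exists id; split => // x; exact: cvg_id.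
exists (real_complex R); split => //; last exact: lecR.
move=> x; apply/cvgrPdist_lt => e e0.
(* A positive element of R[i] is real. *)
have eE : e = real_complex R (complex.Re e).
  by case: e e0 => a b; rewrite ltcE /= => /andP[/eqP -> _].
have e0' : 0 < complex.Re e by rewrite -ltcR -eE.
near=> y.
rewrite -rmorphB normc_def /= expr0n /= addr0 sqrtr_sqr eE ltcR.
by near: y; apply: (@cvgr_dist_lt _ R^o); first exact: cvg_id.
Unshelve. all: by end_near. Qed.

(** Locally compact Hausdorff spaces are completely regular, being subspaces
    of their one-point compactification, which is normal. *)
Lemma scalar_urysohn (R : realType) (s : scalars) (X : topologicalType)
    (x y : X) :
  hausdorff_space X -> locally_compact [set: X] -> x != y ->
  exists p : X -> scalar_field R s,
    [/\ continuous p, forall z, 0 <= p z <= 1, p x = 0 & p y = 1].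
Proof.
move=> hX lX xy.
have : uniform_separator [set x] [set y].
  apply: (@locally_compact_completely_regular X R) => //.
    exact/accessible_closed_set1/hausdorff_accessible.
  exact/eqP.
move=> /(@uniform_separatorP _ R)[p [cp p01 px py]].
have [i [ci i0 i1 le_i]] := @scalar_embedding R s.
exists (i \o p); split=> [z|z||] /=.
- by apply: continuous_comp; [exact: cp|exact: ci].
- by rewrite -i0 -i1 !le_i; have /p01 : range p (p z) by []; rewrite /= in_itv.
- by rewrite (imsub1 px).
- by rewrite (imsub1 py).
Qed.

Theorem theorem1p2p1 (R : realType) (s : scalars) (X : topologicalType)
    (hausdorffX : hausdorff_space X) (lcptX : locally_compact [set: X])
    (f : C0 X (scalar_field R s)) :
  left_symmetric f <->
    (forall x : X, f x = 0) \/
    ((exists x0 : X, norm_attaining_set f = [set x0]) /\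
     forall x : X, ~ norm_attaining_set f x -> f x = 0).
Proof.
split=> [fsym|[f0|[[x0 fx0] foff]]];
  last exact: left_symmetric_peak _ _ fx0 foff.
- have [->|f0] := eqVneq f 0; [by left|right].
  have [x0 fx0] := C0_norm_attained _ f0.
  have f_off x : x != x0 -> f x = 0.
    move=> xx0; apply: contrapT => /eqP fx.
    rewrite eq_sym in xx0.
    have [p [cp p01 px0 px]] := @scalar_urysohn R s X _ _ hausdorffX lcptX xx0.
    have [g gE] := C0_cutoff f _ cp p01.
    have g0 : g != 0.
      by apply: contraNneq fx => g0; rewrite -[f x]mulr1 -px -gE g0.
    apply: (cutoff_not_bj_orthogonal _ _ _ p01 gE g0); apply: fsym.
    by apply: (bj_orthogonal_vanishing _ _ x0) => //; rewrite gE px0 mulr0.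
  split.
    exists x0; apply/seteqP; split=> [x /= fx|x -> //].
    apply/eqP; apply: contraNT f0 => /f_off fx0'.
    by rewrite -normr_eq0 -fx fx0' normr0.
  by move=> x fx; apply: f_off; apply: contra_notN fx => /eqP ->.
- have -> : f = 0 by apply/val_inj/funext.
  by move=> g _ l; rewrite scaler0 addr0.
Qed.
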